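(* Let $m\ge 1$ be an integer, let $\varphi:\mathbf{Z}/m\mathbf{Z}\to\mathbf{C}$ be a function that is not identically zero, and put $c=\max(\|\varphi\|_\infty,\|\widehat\varphi\|_\infty)$. For $2\le N\le m/2$ we have $$|S(\widehat\varphi,N)|+|S(\widehat\varphi,-N)|\ll c\,\sqrt{N}\,m^{1/4}\,\Delta\Bigl(\varphi,\frac{m}{N}\Bigr)^{1/2}$$ and $$\Delta(\widehat\varphi,N)\ll \frac{m^{1/4}}{\sqrt N}\,\Delta\Bigl(\varphi,\frac mN\Bigr)^{1/2}.$$ In particular, for $m\ge 4$, $$\Delta(\widehat\varphi,\sqrt m)\ll\Delta(\varphi,\sqrt m)^{1/2}.$$ All implied constants are absolute.
   Context: Functions on $\mathbf{Z}/m\mathbf{Z}$ are viewed as $m$-periodic functions on $\mathbf{Z}$. The normalized Fourier transform is $\widehat{\varphi}(h)=\frac{1}{\sqrt m}\sum_{x \bmod m}\varphi(x)e(hx/m)$, $h\in\mathbf{Z}$, with $e(t)=\exp(2\pi i t)$; $\|\cdot\|_\infty$ is the maximum of the absolute value over $\mathbf{Z}/m\mathbf{Z}$. For an $m$-periodic function $f$ and a real number $N\ge1$, put $S(f,N)=\sum_{1\le n\le N}f(n)$, and for $N\le -1$ put $S(f,N)=\sum_{N\le n\le -1}f(n)$. For $1\le N\le m/2$ and $f\in\{\varphi,\widehat\varphi\}$ (with the same constant $c$ in both cases), define $$\Delta(f,N)=\frac{1}{\sqrt m}+\max_{1\le t\le m/2}\Bigl\{\min\Bigl(\frac{1}{ct},\frac{1}{cN}\Bigr)\bigl(|S(f,t)|+|S(f,-t)|\bigr)\Bigr\}.$$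 The notation $A\ll B$ means $|A|\le CB$ for some constant $C$. *)

(* Defs.v *)
From mathcomp Require Import all_boot all_order all_algebra.
From mathcomp Require Import all_classical all_reals all_analysis.
From mathcomp Require Export complex.

Set Implicit Arguments.
Unset Strict Implicit.
Unset Printing Implicit Defensive.

Import Order.TTheory GRing.Theory Num.Theory.

Local Open Scope classical_set_scope.
Local Open Scope ring_scope.
Local Open Scope complex_scope.

(* A function on Z/mZ is an m-periodic function on the integers. *)
Definition periodic_mod (T : Type) (m : nat) (f : int -> T) : Prop :=
  forall x : int, f (x + m%:Z) = f x.

Section Definitions.
Variable R : realType.
Implicit Types (m : nat) (f phi : int -> R[i]) (N t c : R).

(* exp(2 i pi t), written by Euler's formula *)
Definition expe t : R[i] := cos (2 * pi * t) +i* sin (2 * pi * t).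

(* The absolute value of R[i] takes values in R[i]; this one is real-valued. *)
Definition cabs (z : R[i]) : R := Normc.normc z.

Definition supnorm m f : R := \big[Num.max/0]_(x < m) cabs (f x%:Z).

Definition fourier m phi (h : int) : R[i] :=
  ((Num.sqrt m%:R)^-1)%:C *
    \sum_(x < m) phi x%:Z * expe (h%:~R * x%:R / m%:R).

(* For N < 0 the range N <= n <= -1 is reindexed by n |-> -n. *)
Definition short_sum f N : R[i] :=
  if 0 <= N then \sum_(1 <= n < (Num.truncn N).+1) f n%:Z
  else \sum_(1 <= n < (Num.truncn (- N)).+1) f (- n%:Z).

Definition cmax m phi : R :=
  Num.max (supnorm m phi) (supnorm m (fourier m phi)).

Definition Delta_term c f N t : R :=
  Num.min (c * t)^-1 (c * N)^-1 * (cabs (short_sum f t) + cabs (short_sum f (- t))).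

(* The real parameter t ranges over an interval; the supremum is a maximum by
   Delta_term_max below. *)
Definition Delta c m f N : R :=
  (Num.sqrt m%:R)^-1
  + sup [set Delta_term c f N t | t in [set t : R | 1 <= t <= m%:R / 2]].

Lemma truncn_short_sum f t : 1 <= t ->
  short_sum f t = short_sum f (Num.truncn t)%:R /\
  short_sum f (- t) = short_sum f (- (Num.truncn t)%:R).
Proof.
move=> t1; have t0 : 0 < t by exact: lt_le_trans t1.
have k1 : (0 < Num.truncn t)%N by rewrite truncn_gt0.
have k0 : 0 < (Num.truncn t)%:R :> R by rewrite ltr0n.
rewrite /short_sum !oppr_ge0 (ltW t0) (ltW k0) leNgt t0 leNgt k0 /=.
by rewrite !opprK natrK.
Qed.

Lemma Delta_term_max c m f N : 0 < c -> 0 < N -> (2 <= m)%N ->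
  exists2 t : R, 1 <= t <= m%:R / 2 &
    forall u : R, 1 <= u <= m%:R / 2 ->
      Delta_term c f N u <= Delta_term c f N t.
Proof.
move=> c0 N0 m2; have M0 : (0 < m./2)%N by rewrite half_gt0.
pose F (k : 'I_(m./2)) := Delta_term c f N k.+1%:R.
case: (@Order.TotalTheory.arg_maxP _ _ _ (Ordinal M0) xpredT F isT) => k _ kmax.
have halfE (n : nat) : (n <= m./2)%N = (n%:R <= m%:R / 2 :> R).
  by rewrite ler_pdivlMr// -natrM ler_nat muln2 geq_half_double.
exists k.+1%:R; first by rewrite ler1n /= -halfE.
move=> u /andP[u1 um]; have u0 : 0 < u by exact: lt_le_trans u1.
have v1 : (0 < Num.truncn u)%N by rewrite truncn_gt0.
have vu : (Num.truncn u)%:R <= u by rewrite truncn_le ltW.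
have vm : ((Num.truncn u).-1 < m./2)%N.
  by rewrite prednK// halfE (le_trans vu).
apply: (le_trans _ (kmax (Ordinal vm) isT)).
rewrite /F /Delta_term /= prednK//.
have [-> ->] := truncn_short_sum f u1.
have cabs_ge0 z : 0 <= cabs z by case: z => a b; exact: sqrtr_ge0.
apply: ler_wpM2r; first by rewrite addr_ge0.
have v0 : 0 < (Num.truncn u)%:R :> R by rewrite ltr0n.
by rewrite le_min !ge_min lexx orbT andbT lef_pV2 ?posrE ?mulr_gt0// ler_pM2l// vu.
Qed.

End Definitions.

(* Main.v *)
Require Import Defs.
From mathcomp Require Import all_boot all_order all_algebra.
From mathcomp Require Import all_classical all_reals all_analysis.
From mathcomp Require Import zify ring lra.
Import Order.TTheory GRing.Theory Num.Theory.
Import numFieldNormedType.Exports.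
Import Defs.
Local Open Scope ring_scope.

Set Implicit Arguments.
Unset Strict Implicit.
Unset Printing Implicit Defensive.

(** The bound for S(phihat, N) is proved by smoothing and then transferring the
sum to the side of phi.

Write K for the integer part of N, D for Delta(phi, m/N) and c for the common
bound of phi and phihat.  Shifting the range of summation by h changes
S(phihat, K) by at most 2hc, so averaging over the shifts a + b with
1 <= a, b <= H costs at most 4Hc ([fourier_sum_smoothing]).  By definition of
phihat the averaged sum is m^(-1/2) times the sum of phi(x) G(e(x/m)) over the
residues x, where G(z) = P_K(z) (P_H(z) / H)^2 and P_n(z) = z + ... + z^n.
This kernel is concentrated on |x| <= m/K, and has quadratic decay beyond m/H.

The residues are cut into 0, the positive ones up to m/2 and the negative ones
([sum_periodic_split]).  On each side one sums by parts: the partial sums of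
phi up to t are at most c D max(t, m/N) by the very definition of Delta, and
consecutive values of the kernel differ by at most
(6 pi K / m) min(K, m/t) min(1, m/(Ht))^2 ([skernel_shift]).  As
max(t, m/N) min(K, m/t) <= m, the weight of phi disappears, and the sum of
min(1, m/(Ht))^2 over t is at most 4m/H.  The exponent 2 is what avoids a
logarithm here: with a single average over shifts, this would be a harmonic sum.
Altogether

  |S(phihat, N)| << H c + c sqrt(N) + c D N sqrt(m) / H     for 1 <= H <= K,

([one_sided_sum_le], [fourier_sum_le]), and the two main terms balance for
H ~ X = sqrt(N D sqrt(m)), which gives the claim |S(phihat, N)| << c X.  The
inequality D >= m^(-1/2) built into Delta ensures X >= sqrt(N) >= 1, so that this
H is admissible and absorbs the middle term; when X >= K the claim is the trivial
bound ([fourier_sum_le_sqrt]).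

For Delta(phihat, N) one applies this bound with every t in [1, m/2] in place of
N; it then remains to compare Delta(phi, m/t) with Delta(phi, m/N), and for that
Delta(phi, M) is nonincreasing in M (used for t <= N) while M Delta(phi, M) is
nondecreasing (used for t >= N).  The last claim is the case N = sqrt(m). *)

(** * The absolute value on complex numbers *)

Lemma cabs_ge0 (R : realType) (z : R[i]%C) : 0 <= cabs z.
Proof. by case: z => a b; exact: sqrtr_ge0. Qed.

Lemma cabs0 (R : realType) : cabs (0 : R[i]%C) = 0.
Proof. exact: Normc.normc0. Qed.

Lemma cabs1 (R : realType) : cabs (1 : R[i]%C) = 1.
Proof. exact: Normc.normc1. Qed.

Lemma cabsM (R : realType) (z w : R[i]%C) : cabs (z * w) = cabs z * cabs w.
Proof. exact: Normc.normcM. Qed.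

Lemma cabsX (R : realType) (z : R[i]%C) n : cabs (z ^+ n) = cabs z ^+ n.
Proof. by elim: n => [|n IH]; rewrite ?cabs1// !exprS cabsM IH. Qed.

Lemma cabsN (R : realType) (z : R[i]%C) : cabs (- z) = cabs z.
Proof. exact: normcN. Qed.

Lemma ler_cabsD (R : realType) (z w : R[i]%C) : cabs (z + w) <= cabs z + cabs w.
Proof. exact: le_normcD. Qed.

Lemma ler_cabsB (R : realType) (z w : R[i]%C) : cabs (z - w) <= cabs z + cabs w.
Proof. by rewrite -[cabs w]cabsN ler_cabsD. Qed.

Lemma ler_cabs_sum (R : realType) (I : Type) (r : seq I) (P : pred I)
    (f : I -> R[i]%C) :
  cabs (\sum_(i <- r | P i) f i) <= \sum_(i <- r | P i) cabs (f i).
Proof.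
elim/big_rec2: _ => [|i y z _ H]; first by rewrite cabs0.
by apply: le_trans (ler_cabsD _ _) _; rewrite lerD2l.
Qed.

Lemma cabsR (R : realType) (x : R) : cabs (x%:C)%C = `|x|.
Proof. by rewrite /cabs /= expr0n /= addr0 sqrtr_sqr. Qed.

Lemma cabs_nat (R : realType) (n : nat) : cabs (n%:R : R[i]%C) = n%:R.
Proof.
have -> : (n%:R : R[i]%C) = ((n%:R)%:C)%C by rewrite rmorph_nat.
by rewrite cabsR normr_nat.
Qed.

Lemma cabsV (R : realType) (z : R[i]%C) : cabs z^-1 = (cabs z)^-1.
Proof. exact: Normc.normcV. Qed.

(** * Geometric sums and the smoothing kernel *)

(** The exponents start at 1 to match sums over 1 <= n <= N. *)
Definition geosum (R : realType) (z : R[i]%C) (n : nat) : R[i]%C :=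
  \sum_(i < n) z ^+ i.+1.

Lemma geosumS (R : realType) (z : R[i]%C) n :
  geosum z n.+1 = z * (1 + geosum z n).
Proof.
rewrite /geosum big_ord_recl expr1 mulrDr mulr1 mulr_sumr.
by congr (_ + _); apply: eq_bigr => i _; rewrite -exprS.
Qed.

Lemma geosum_le_nat (R : realType) (z : R[i]%C) n :
  cabs z = 1 -> cabs (geosum z n) <= n%:R.
Proof.
move=> z1; apply: le_trans (ler_cabs_sum _ _ _) _.
rewrite (eq_bigr (fun=> 1)) => [|i _]; last by rewrite cabsX z1 expr1n.
by rewrite sumr_const card_ord.
Qed.

Lemma geosum_le_inv (R : realType) (z : R[i]%C) n :
  cabs z = 1 -> cabs (geosum z n) * cabs (z - 1) <= 2.
Proof.
move=> z1; have -> : cabs (geosum z n) * cabs (z - 1) = cabs (z * (z ^+ n - 1)).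
  rewrite -cabsM; congr cabs; elim: n => [|n IH].
    by rewrite /geosum big_ord0 mul0r expr0 subrr mulr0.
  by rewrite geosumS -mulrA mulrDl mul1r IH exprS; ring.
rewrite cabsM z1 mul1r; apply: le_trans (ler_cabsB _ _) _.
by rewrite cabsX z1 expr1n cabs1.
Qed.

(** Putting E n for the difference, geosum z n.+1 = z (1 + geosum z n) gives
E n.+1 = z w E n + (w - 1) geosum z n.+1.  So moving z by the factor w costs n
times the size of the geometric sums themselves, and the decay of these sums
away from z = 1 is kept; the termwise estimate of z^i (w^i - 1) would lose it. *)
Lemma geosum_shift (R : realType) (z w : R[i]%C) n (B : R) :
  cabs z = 1 -> cabs w = 1 -> (forall j, (j <= n)%N -> cabs (geosum z j) <= B) ->
  cabs (geosum (z * w) n - geosum z n) <= n%:R * B * cabs (w - 1).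
Proof.
move=> z1 w1; elim: n => [|n IH] bB.
  by rewrite /geosum !big_ord0 subrr cabs0 !mul0r.
have -> : geosum (z * w) n.+1 - geosum z n.+1 =
    z * w * (geosum (z * w) n - geosum z n) + (w - 1) * geosum z n.+1.
  by rewrite !geosumS; ring.
apply: le_trans (ler_cabsD _ _) _.
rewrite !cabsM z1 w1 !mul1r.
rewrite -natr1 !mulrDl mul1r [leRHS]addrC [leLHS]addrC mulrC.
rewrite lerD ?ler_wpM2r ?cabs_ge0 ?bB// IH// => j jn.
by rewrite bB// leqW.
Qed.

(** The multiplier that replaces geosum z K when a sum of length K is averaged
over the shifts a + b with 1 <= a, b <= H. *)
Definition skernel (R : realType) (K H : nat) (z : R[i]%C) : R[i]%C :=
  geosum z K * (geosum z H / H%:R) ^+ 2.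

(** Product rule for finite differences.  The relative variation of the smoothing
factor is of order H, that of geosum z K of order K, and H <= K. *)
Lemma skernel_shift (R : realType) (K H : nat) (z w : R[i]%C) (A a : R) :
  (0 < H <= K)%N -> cabs z = 1 -> cabs w = 1 ->
  (forall j, (j <= K)%N -> cabs (geosum z j) <= A) ->
  (forall j, (j <= H)%N -> cabs (geosum z j) <= H%:R * a) ->
  cabs (geosum (z * w) H) <= H%:R * a ->
  cabs (skernel K H (z * w) - skernel K H z) <=
    3 * K%:R * cabs (w - 1) * (A * a ^+ 2).
Proof.
move=> /andP[H0 HK] z1 w1 zA za zwa.
have H0' : 0 < H%:R :> R by rewrite ltr0n.
set u := geosum (z * w) H / H%:R; set v := geosum z H / H%:R.
have ua : cabs u <= a.
  by rewrite /u cabsM cabsV cabs_nat ler_pdivrMr// [leRHS]mulrC.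
have va : cabs v <= a.
  by rewrite /v cabsM cabsV cabs_nat ler_pdivrMr// [leRHS]mulrC za.
have uv : cabs (u - v) <= H%:R * a * cabs (w - 1).
  have -> : u - v = (geosum (z * w) H - geosum z H) / H%:R by rewrite /u /v mulrBl.
  rewrite cabsM cabsV cabs_nat ler_pdivrMr//.
  apply: le_trans (geosum_shift z1 w1 za) _.
  by rewrite le_eqVlt; apply/orP; left; apply/eqP; ring.
have ab := geosum_shift z1 w1 zA.
have bA := zA _ (leqnn K).
have -> : skernel K H (z * w) - skernel K H z =
    (geosum (z * w) K - geosum z K) * u ^+ 2 + geosum z K * ((u - v) * (u + v)).
  by rewrite /skernel -/u -/v; ring.
apply: le_trans (ler_cabsD _ _) _; rewrite 3!cabsM cabsX expr2.
have a0 : 0 <= a := le_trans (cabs_ge0 _) ua.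
have A0 : 0 <= A := le_trans (cabs_ge0 _) bA.
have HK' : H%:R <= K%:R :> R by rewrite ler_nat.
have d0 := cabs_ge0 (w - 1).
have upv : cabs (u + v) <= 2 * a.
  by apply: le_trans (ler_cabsD _ _) _; lra.
have -> : 3 * K%:R * cabs (w - 1) * (A * a ^+ 2) =
   K%:R * A * cabs (w - 1) * (a * a) + A * (K%:R * a * cabs (w - 1) * (2 * a)).
  by ring.
apply: lerD; apply: ler_pM; rewrite ?mulr_ge0 ?cabs_ge0//.
  by apply: ler_pM; rewrite ?cabs_ge0.
apply: ler_pM; rewrite ?cabs_ge0//.
apply: le_trans uv _; apply: ler_wpM2r => //; exact: ler_wpM2r.
Qed.

(** * Summation by parts on one side of the origin *)

Lemma sum_by_parts (V : comPzRingType) (f G : nat -> V) L :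
  \sum_(i < L) f i.+1 * G i.+1 =
  (\sum_(i < L) f i.+1) * G L +
  \sum_(i < L) (\sum_(j < i) f j.+1) * (G i - G i.+1).
Proof.
elim: L => [|L IH]; first by rewrite !big_ord0 mul0r addr0.
rewrite big_ord_recr /= IH [in RHS]big_ord_recr /= [X in _ = _ + X]big_ord_recr /=.
by ring.
Qed.

(** The hypotheses say that a is at most min(1, B / j.+1), so a (j.+1 + B) <= 2B;
hence a^2 is at most a constant times the summand of a telescoping series whose
total is 4B. *)
Lemma sqr_min_telescope (R : realFieldType) (B a : R) (j : nat) :
  0 < B -> 0 <= a -> a <= 1 -> a * j.+1%:R <= B ->
  a ^+ 2 <= 4 * B ^+ 2 * ((j%:R + B)^-1 - (j.+1%:R + B)^-1).
Proof.
move=> B0 a0 a1 aB; have j0 : 0 <= j%:R :> R by [].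
have p1 : 0 < j%:R + B by lra.
have p2 : 0 < j.+1%:R + B by rewrite -natr1; lra.
have -> : (j%:R + B)^-1 - (j.+1%:R + B)^-1 = ((j%:R + B) * (j.+1%:R + B))^-1.
  by rewrite -natr1 in p2 *; field; rewrite !lt0r_neq0.
rewrite ler_pdivlMr ?mulr_gt0//.
have le1 : a * (j.+1%:R + B) <= 2 * B by nra.
have le2 : a * (j%:R + B) <= 2 * B by move: le1; rewrite -natr1; lra.
have -> : a ^+ 2 * ((j%:R + B) * (j.+1%:R + B)) =
  (a * (j%:R + B)) * (a * (j.+1%:R + B)) by ring.
have -> : 4 * B ^+ 2 = (2 * B) * (2 * B) by ring.
by apply: ler_pM => //; apply: mulr_ge0 => //; apply: ltW.
Qed.

(** The sum of f(t) G(w^t) for t = 1, ..., L, where w plays the part of e(1/m) or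
e(-1/m).  The bound Q max(t, M) for the partial sums of f grows linearly from
t = M on; the decay min(K, m/t) of the geometric sum of length K cancels this
growth exactly, and the square of the smoothing factor makes the rest summable. *)
Lemma one_sided_sum_le (R : realType) (m : R) (L K H : nat) (f : nat -> R[i]%C)
    (Q M : R) (w : R[i]%C) :
  0 < m -> 0 <= Q -> 0 <= M -> M * K%:R <= m -> (0 < H <= K)%N ->
  ((0 < L)%N -> m <= 4 * L%:R) ->
  (forall t, (0 < t <= L)%N ->
     cabs (\sum_(i < t) f i.+1) <= Q * Num.max t%:R M) ->
  cabs w = 1 -> cabs (w - 1) <= 2 * pi / m ->
  (forall t, (0 < t <= L)%N -> 2 * t%:R / m <= cabs (w ^+ t - 1)) ->
  cabs (\sum_(i < L) f i.+1 * skernel K H (w ^+ i.+1)) <=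
    (24 * pi + 4) * (Q * K%:R * m / H%:R).
Proof.
move=> m0 Q0 M0 MK /andP[H0 HK] mL fQ w1 wpi wge.
have pi0 : 0 <= pi :> R := pi_ge0 R.
have H0' : 0 < H%:R :> R by rewrite ltr0n.
have K1' : 1 <= K%:R :> R by rewrite ler1n (leq_trans H0).
have z1 t : cabs (w ^+ t) = 1 by rewrite cabsX w1 expr1n.
case: L mL fQ wge => [|L] mL fQ wge.
  rewrite big_ord0 cabs0 mulr_ge0 ?addr_ge0 ?mulr_ge0 ?invr_ge0 ?(ltW H0') ?(ltW m0)//.
(* A t and a t bound, at w^t, the geometric sum of length K and the
   smoothing factor; B is the point where the latter starts to decay. *)
pose B := m / H%:R.
have B0 : 0 < B by rewrite divr_gt0.
pose A t : R := Num.min K%:R (m / t%:R).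
pose a t : R := Num.min 1 (B / t%:R).
have geoA n t j : (0 < t <= L.+1)%N -> (j <= n)%N ->
    cabs (geosum (w ^+ t) j) <= Num.min n%:R (m / t%:R).
  move=> tL jn; have t0 : 0 < t%:R :> R by rewrite ltr0n; case/andP: tL.
  rewrite le_min; apply/andP; split.
    by apply: le_trans (geosum_le_nat _ (z1 t)) _; rewrite ler_nat.
  rewrite ler_pdivlMr//.
  have g0 := cabs_ge0 (geosum (w ^+ t) j).
  have h1 := geosum_le_inv j (z1 t).
  have h2 : cabs (geosum (w ^+ t) j) * (2 * t%:R / m) <= 2.
    by apply: le_trans h1; apply: ler_wpM2l => //; exact: wge.
  have : cabs (geosum (w ^+ t) j) * (2 * t%:R / m) * m <= 2 * m by rewrite ler_pM2r.
  have -> : cabs (geosum (w ^+ t) j) * (2 * t%:R / m) * m =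
    2 * (cabs (geosum (w ^+ t) j) * t%:R) by field; rewrite lt0r_neq0.
  by rewrite ler_pM2l.
have HaE t : Num.min H%:R (m / t%:R) = H%:R * a t.
  rewrite /a minr_pMr ?(ltW H0')// mulr1; congr Num.min.
  by rewrite /B [RHS]mulrA [H%:R * _]mulrC divfK ?lt0r_neq0.
have a0 t : 0 <= a t.
  by rewrite le_min ler01 divr_ge0// ltW.
have a1 t : a t <= 1 by rewrite ge_min lexx.
have A0 t : 0 <= A t.
  by rewrite le_min ler0n divr_ge0// ltW.
(* t min(K, m/t) <= m and M min(K, m/t) <= M K <= m. *)
have maxA t : (0 < t)%N -> Num.max t%:R M * A t <= m.
  move=> t0; have t0' : 0 < t%:R :> R by rewrite ltr0n.
  rewrite maxr_pMl ?A0// ge_max; apply/andP; split.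
    rewrite mulrC -ler_pdivlMr// ge_min lexx orbT//.
  by apply: le_trans MK; rewrite ler_wpM2l// ge_min lexx.
have aB t : (0 < t)%N -> a t * t%:R <= B.
  by move=> t0; rewrite -ler_pdivlMr ?ltr0n// ge_min lexx orbT.
have adec t : (0 < t)%N -> a t.+1 <= a t.
  move=> t0; rewrite /a le_min !ge_min lexx /=; apply/orP; right.
  by rewrite ler_pM2l// lef_pV2 ?posrE ?ltr0n// ler_nat.
rewrite (sum_by_parts f (fun i => skernel K H (w ^+ i))).
apply: le_trans (ler_cabsD _ _) _.
rewrite cabsM mulrDl [leRHS]addrC; apply: lerD.
  (* The boundary term: L is comparable to m, so one factor
     a L.+1 <= 4 / H suffices. *)
  have sk : cabs (skernel K H (w ^+ L.+1)) <= A L.+1 * a L.+1.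
    rewrite /skernel cabsM; apply: ler_pM; rewrite ?cabs_ge0//.
      by apply: geoA; rewrite ?ltnS ?leqnn.
    have ga : cabs (geosum (w ^+ L.+1) H / H%:R) <= a L.+1.
      rewrite cabsM cabsV cabs_nat ler_pdivrMr// [leRHS]mulrC -HaE.
      by apply: geoA; rewrite ?ltnS ?leqnn.
    rewrite cabsX; apply: le_trans (_ : a L.+1 ^+ 2 <= _).
      by rewrite ler_sqr ?nnegrE ?cabs_ge0.
    by rewrite expr2 ler_piMr.
  apply: le_trans (_ : (Q * Num.max L.+1%:R M) * (A L.+1 * a L.+1) <= _).
    by apply: ler_pM; rewrite ?cabs_ge0// fQ// ltnS leqnn.
  have -> : Q * Num.max L.+1%:R M * (A L.+1 * a L.+1) =
    Q * ((Num.max L.+1%:R M * A L.+1) * a L.+1) by ring.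
  have -> : 4 * (Q * K%:R * m / H%:R) = Q * (m * (4 * K%:R / H%:R)) by ring.
  apply: ler_wpM2l => //; apply: ler_pM; rewrite ?maxA//.
    by rewrite mulr_ge0// le_max ler0n.
  apply: le_trans (_ : B / L.+1%:R <= _); first by rewrite ge_min lexx orbT.
  rewrite /B ler_pdivrMr ?ltr0n//.
  rewrite mulrAC ler_pM2r ?invr_gt0//.
  by apply: le_trans (mL isT) _; rewrite ler_wpM2r// ler_peMr.
(* C collects the constants of skernel_shift, of the partial sums of f and
   of sqr_min_telescope; the telescoping sum is then at most C / B. *)
pose C := 3 * K%:R * (2 * pi / m) * Q * m * (4 * B ^+ 2).
have C0 : 0 <= C.
  by rewrite /C !mulr_ge0 ?invr_ge0 ?exprn_ge0// ltW.
(* The term at index 0 vanishes: it carries an empty partial sum of f. *)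
rewrite big_ord_recl /= big_ord0 mul0r add0r.
apply: le_trans (ler_cabs_sum _ _ _) _.
apply: le_trans (_ : \sum_(0 <= j < L)
  - C * ((j.+1%:R + B)^-1 - (j%:R + B)^-1) <= _); last first.
  rewrite -mulr_sumr telescope_sumr// add0r.
  have -> : 24 * pi * (Q * K%:R * m / H%:R) = C * B^-1.
    by rewrite /C /B; field; rewrite !lt0r_neq0.
  rewrite mulNr -mulrN ler_wpM2l// opprB gerBl invr_ge0.
  by rewrite addr_ge0// ltW.
rewrite big_mkord; apply: ler_sum => j _.
rewrite /bump /= add1n.
have jL : (0 < j.+1 <= L.+1)%N by apply/andP; split=> //; exact: ltnW (ltn_ord j).
have j2L : (0 < j.+2 <= L.+1)%N by apply/andP; split=> //; exact: ltn_ord j.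
have sh : cabs (skernel K H (w ^+ j.+1 * w) - skernel K H (w ^+ j.+1)) <=
    3 * K%:R * cabs (w - 1) * (A j.+1 * a j.+1 ^+ 2).
  apply: skernel_shift => //; first by rewrite H0.
  - by move=> i iK; exact: geoA.
  - by move=> i iH; rewrite -HaE; exact: geoA.
  rewrite -exprSr; apply: le_trans (_ : H%:R * a j.+2 <= _).
    by rewrite -HaE; exact: geoA.
  by rewrite ler_pM2l// adec.
rewrite cabsM -[X in _ * X]cabsN opprB [w ^+ j.+2]exprSr.
apply: le_trans (_ : (Q * Num.max j.+1%:R M) *
    (3 * K%:R * (2 * pi / m) * (A j.+1 * a j.+1 ^+ 2)) <= _).
  apply: ler_pM; rewrite ?cabs_ge0//; first exact: fQ.
  apply: le_trans sh _; apply: ler_wpM2r; first by rewrite mulr_ge0 ?exprn_ge0.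
  by apply: ler_wpM2l => //; rewrite mulr_ge0.
have -> : (Q * Num.max j.+1%:R M) *
    (3 * K%:R * (2 * pi / m) * (A j.+1 * a j.+1 ^+ 2)) =
    (3 * K%:R * (2 * pi / m) * Q) *
      ((Num.max j.+1%:R M * A j.+1) * a j.+1 ^+ 2) by ring.
rewrite mulNr -mulrN opprB.
have -> : C * ((j%:R + B)^-1 - (j.+1%:R + B)^-1) =
    (3 * K%:R * (2 * pi / m) * Q) *
      (m * (4 * B ^+ 2 * ((j%:R + B)^-1 - (j.+1%:R + B)^-1))) by rewrite /C; ring.
have X0 : 0 <= 3 * K%:R * (2 * pi / m) * Q by rewrite !mulr_ge0// invr_ge0 ltW.
apply: ler_wpM2l => //; apply: ler_pM; rewrite ?maxA ?exprn_ge0//.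
  by rewrite mulr_ge0// le_max ler0n.
by apply: sqr_min_telescope => //; exact: aB.
Qed.

(** * Additive characters *)

Lemma sin_le_id (R : realType) (y : R) : 0 <= y -> sin y <= y.
Proof.
move=> y0.
have [|c _] := @MVT_segment R sin cos 0 y y0 (fun x _ => is_derive_sin x).
  by apply: continuous_subspaceT; exact: continuous_sin.
rewrite sin0 !subr0 => ->.
by rewrite ler_piMl// cos_le1.
Qed.

(** A weak form of the inequality of Jordan: as cos^2 >= 1/2 on [0, pi/4], writing
sin y = 2 sin(y/2) cos(y/2) and applying the mean value theorem to sin(y/2) gives
sin y = y cos(t) cos(y/2) >= y/2 with some t in [0, y/2]. *)
Lemma half_le_sin (R : realType) (y : R) : 0 <= y <= pi / 2 -> y / 2 <= sin y.
Proof.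
move=> /andP[y0 y1].
have pi0 := pi_gt0 R.
pose z := y / 2.
have z0 : 0 <= z by rewrite divr_ge0.
have zpi : z <= pi / 4 by rewrite /z; lra.
have -> : y = z *+ 2 by rewrite /z mulr2n; lra.
clearbody z.
have ccos x : 0 <= x <= z -> 1 / 2 <= cos x ^+ 2.
  move=> /andP[x0 xz].
  have : 0 <= cos (x *+ 2).
    by apply: cos_ge0_pihalf; rewrite -[x *+ 2]mulr_natr; apply/andP; split; lra.
  by rewrite cos_mulr2n -[_ *+ 2]mulr_natr; lra.
have cge0 x : 0 <= x <= z -> 0 <= cos x.
  by move=> /andP[x0 xz]; apply: cos_ge0_pihalf; apply/andP; split; lra.
have [|t tz] := @MVT_segment R sin cos 0 z z0 (fun x _ => is_derive_sin x).
  by apply: continuous_subspaceT; exact: continuous_sin.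
rewrite sin0 !subr0 => sz.
rewrite sin_mulr2n sz.
have tz' : 0 <= t <= z by move: tz; rewrite in_itv.
have zz : 0 <= z <= z by rewrite z0 lexx.
have := ccos _ tz'; have := ccos _ zz.
have := cge0 _ tz'; have := cge0 _ zz.
set p := cos z; set q := cos t => p0 q0 p2 q2.
have pq : 1 / 2 <= p * q.
  rewrite -ler_sqr ?nnegrE ?mulr_ge0//; first by rewrite exprMn; nra.
rewrite mulr2n [leRHS]mulr2n; nra.
Qed.

Lemma cabs_expe (R : realType) (t : R) : cabs (expe t) = 1.
Proof. by rewrite /cabs /expe /= cos2Dsin2 sqrtr1. Qed.

Lemma expe_zero (R : realType) : expe (0 : R) = 1.
Proof. by rewrite /expe mulr0 cos0 sin0. Qed.

Lemma expeD (R : realType) (s t : R) : expe (s + t) = expe s * expe t.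
Proof.
rewrite /expe mulrDr cosD sinD; apply/eqP; rewrite eq_complex /=.
by rewrite eqxx /= addrC [X in _ + X]mulrC [X in X + _]mulrC eqxx.
Qed.

Lemma expeMn (R : realType) (t : R) n : expe (n%:R * t) = expe t ^+ n.
Proof.
elim: n => [|n IH]; first by rewrite mul0r expe_zero.
by rewrite -natr1 mulrDl mul1r expeD IH exprSr.
Qed.

Lemma expe_int (R : realType) (k : int) : expe (k%:~R : R) = 1.
Proof.
have e1 : expe (1 : R) = 1.
  by rewrite /expe mulr1 mulrC mulr_natr cos2pi sin2pi.
case: k => n; first by rewrite -pmulrn -[n%:R]mulr1 expeMn e1 expr1n.
apply: (@mulrI _ (expe n.+1%:R)).
  by rewrite -[n.+1%:R]mulr1 expeMn e1 expr1n unitr1.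
rewrite -expeD NegzE mulrNz -pmulrn subrr expe_zero -[n.+1%:R]mulr1 expeMn e1 expr1n mulr1//.
Qed.

Lemma cabs_expe_sub1 (R : realType) (t : R) :
  cabs (expe t - 1) = 2 * `|sin (pi * t)|.
Proof.
have -> : 2 * `|sin (pi * t)| = `|2 * sin (pi * t)| by rewrite normrM gtr0_norm.
rewrite -sqrtr_sqr /cabs /expe /= subr0; congr Num.sqrt.
have -> : 2 * pi * t = (pi * t) *+ 2 by rewrite mulr2n; ring.
rewrite cos_mulr2n sin_mulr2n.
have := cos2Dsin2 (pi * t); set p := cos _; set q := sin _ => h.
have pE : p ^+ 2 = 1 - q ^+ 2 by lra.
rewrite !mulr2n pE.
have -> : (p * q + p * q) ^+ 2 = 4 * p ^+ 2 * q ^+ 2 by ring.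
rewrite pE.
by ring.
Qed.

Lemma cabs_expeN_sub1 (R : realType) (t : R) :
  cabs (expe (- t) - 1) = cabs (expe t - 1).
Proof. by rewrite !cabs_expe_sub1 mulrN sinN normrN. Qed.

Lemma expe_sub1_le (R : realType) (t : R) :
  0 <= t <= 1 -> cabs (expe t - 1) <= 2 * pi * t.
Proof.
move=> /andP[t0 t1]; have pi0 := pi_gt0 R.
rewrite cabs_expe_sub1 -mulrA ler_pM2l// ger0_norm.
  by rewrite sin_le_id// mulr_ge0// ltW.
by rewrite sin_ge0_pi// mulr_ge0 ?(ltW pi0)//= ler_piMr// ltW.
Qed.

Lemma expe_sub1_ge (R : realType) (t : R) :
  0 <= t <= 1 / 2 -> 2 * t <= cabs (expe t - 1).
Proof.
move=> /andP[t0 t1]; have pi0 := pi_ge2 R.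
rewrite cabs_expe_sub1 ler_pM2l//; apply: le_trans (ler_norm _).
apply: le_trans (half_le_sin _); first nra.
by apply/andP; split; nra.
Qed.

(** * Periodic functions and the Fourier transform *)

Lemma periodic_addMn (T : Type) m (f : int -> T) (k : nat) x :
  periodic_mod m f -> f (x + (k * m)%N%:Z) = f x.
Proof.
move=> pf; elim: k => [|k IH]; first by rewrite mul0n addr0.
by rewrite mulSn addnC PoszD addrA pf.
Qed.

Lemma periodic_modn (T : Type) m (f : int -> T) x : (0 < m)%N ->
  periodic_mod m f -> exists2 y : nat, (y < m)%N & f x = f y%:Z.
Proof.
move=> m0 pf; exists `|(x %% m%:Z)%Z|%N.
  by rewrite -ltz_nat gez0_abs ?modz_ge0 ?ltz_mod// ?eqz_nat -?lt0n.
rewrite gez0_abs ?modz_ge0 ?eqz_nat -?lt0n//.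
rewrite {1}(divz_eq x m%:Z) addrC; case: (x %/ m%:Z)%Z => n.
  by rewrite -PoszM periodic_addMn.
by rewrite NegzE mulNr -PoszM -[LHS](@periodic_addMn _ m f n.+1)// subrK.
Qed.

(** The last L' residues x are replaced by x - m. *)
Lemma sum_periodic_split (V : zmodType) m L L' (f : int -> V) :
  periodic_mod m f -> m = (L + L').+1 ->
  \sum_(x < m) f x%:Z =
  f 0 + \sum_(i < L) f i.+1%:Z + \sum_(i < L') f (- i.+1%:Z).
Proof.
move=> pf mE; rewrite -(big_mkord xpredT (fun x => f x%:Z)) mE.
rewrite big_ltn// (big_cat_nat (n := L.+1))//= ?ltnS ?leq_addr// addrA.
congr (_ + _ + _).
  by rewrite big_add1 big_mkord.
rewrite -[L.+1]add0n big_addn subSS addKn big_mkord [RHS](reindex_inj rev_ord_inj) /=.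
apply: eq_bigr => i _; rewrite -[in RHS]pf; congr f.
by have := ltn_ord i; lia.
Qed.

(** Splitting off the residue 0 and taking all the others as negative turns one
sum into the other. *)
Lemma sum_periodic_opp (V : zmodType) m (f : int -> V) : (0 < m)%N ->
  periodic_mod m f -> \sum_(x < m) f (- x%:Z) = \sum_(x < m) f x%:Z.
Proof.
case: m => // m _ pf.
rewrite (sum_periodic_split (L := 0) (L' := m) pf)// big_ord0 addr0.
by rewrite big_ord_recl /= oppr0; congr (_ + _).
Qed.

Lemma periodic_opp (T : Type) m (f : int -> T) :
  periodic_mod m f -> periodic_mod m (fun x => f (- x)).
Proof. by move=> pf x; rewrite -[LHS]pf; congr f; lia. Qed.

Lemma cabs_le_supnorm (R : realType) m (f : int -> R[i]%C) x : (0 < m)%N ->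
  periodic_mod m f -> cabs (f x) <= supnorm m f.
Proof.
move=> m0 pf; have [y ym ->] := periodic_modn x m0 pf.
rewrite /supnorm; exact: (le_bigmax _ (fun i : 'I_m => cabs (f i%:Z)) (Ordinal ym)).
Qed.

Lemma expe_intD (R : realType) (t : R) (k : int) : expe (t + k%:~R) = expe t.
Proof. by rewrite expeD expe_int mulr1. Qed.

Lemma fourier_periodic (R : realType) m (phi : int -> R[i]%C) : (0 < m)%N ->
  periodic_mod m (fourier m phi).
Proof.
move=> m0 h; rewrite /fourier; congr (_ * _); apply: eq_bigr => x _; congr (_ * _).
have m0' : m%:R != 0 :> R by rewrite pnatr_eq0 -lt0n.
rewrite -[RHS](expe_intD _ x%:Z); congr expe.
by rewrite intrD -!pmulrn; field.
Qed.

Lemma fourier_opp (R : realType) m (phi : int -> R[i]%C) h : (0 < m)%N ->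
  periodic_mod m phi -> fourier m (fun x => phi (- x)) h = fourier m phi (- h).
Proof.
move=> m0 pf; rewrite /fourier; congr (_ * _).
have m0' : m%:R != 0 :> R by rewrite pnatr_eq0 -lt0n.
pose g (x : int) := phi x * expe ((- h)%:~R * x%:~R / m%:R : R).
have pg : periodic_mod m g.
  move=> x; rewrite /g pf; congr (_ * _).
  rewrite -[RHS](expe_intD _ (- h)); congr expe.
  by rewrite intrD -!pmulrn; field.
transitivity (\sum_(x < m) g (- x%:Z)).
  by apply: eq_bigr => x _; rewrite /g !mulrNz mulrNN.
by rewrite (sum_periodic_opp m0 pg).
Qed.

(** Averaging over one family of shifts multiplies the coefficient of z^k by a
geometric sum; it is used three times, once for the range of summation and twice
for the shifts. *)
Lemma sum_expr_geosum (R : realType) (I : finType) (g z : I -> R[i]%C) k n :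
  \sum_(a < n) \sum_x g x * z x ^+ (k + a.+1) =
  \sum_x (g x * geosum (z x) n) * z x ^+ k.
Proof.
rewrite exchange_big; apply: eq_bigr => x _.
rewrite /geosum mulr_sumr mulr_suml; apply: eq_bigr => a _.
by rewrite exprD; ring.
Qed.

(** Each unit shift exchanges one term of the sum for another. *)
Lemma sum_shift_le (R : realType) (F : nat -> R[i]%C) (c : R) K s :
  (forall n, cabs (F n) <= c) ->
  cabs (\sum_(n < K) F n.+1 - \sum_(n < K) F (s + n.+1)%N) <= 2 * s%:R * c.
Proof.
move=> Fc; elim: s => [|s IH].
  rewrite mulr0 mul0r -sumrB big1 ?cabs0// => i _; exact: subrr.
have -> : \sum_(n < K) F n.+1 - \sum_(n < K) F (s.+1 + n.+1)%N =
    (\sum_(n < K) F n.+1 - \sum_(n < K) F (s + n.+1)%N) + (F s.+1 - F (s + K.+1)%N).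
  have h : F s.+1 + \sum_(n < K) F (s.+1 + n.+1)%N =
      \sum_(n < K) F (s + n.+1)%N + F (s + K.+1)%N.
    transitivity (\sum_(n < K.+1) F (s + n.+1)%N); last by rewrite big_ord_recr.
    rewrite big_ord_recl /= addn1; congr (_ + _); apply: eq_bigr => i _.
    by congr F; rewrite /bump /=; lia.
  have -> : \sum_(n < K) F (s.+1 + n.+1)%N =
      \sum_(n < K) F (s + n.+1)%N + F (s + K.+1)%N - F s.+1.
    by rewrite -h addrC addKr.
  by ring.
apply: le_trans (ler_cabsD _ _) _.
rewrite -[s.+1%:R]natr1 mulrDr mulr1 mulrDl; apply: lerD => //.
apply: le_trans (ler_cabsB _ _) _.
by have := Fc s.+1; have := Fc (s + K.+1)%N; lra.
Qed.

Lemma skernel_le (R : realType) K H (z : R[i]%C) : (0 < H)%N ->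
  cabs z = 1 -> cabs (skernel K H z) <= K%:R.
Proof.
move=> H0 z1; rewrite /skernel cabsM cabsX cabsM cabsV cabs_nat.
rewrite -[leRHS]mulr1; apply: ler_pM; rewrite ?exprn_ge0 ?mulr_ge0 ?cabs_ge0 ?invr_ge0//.
  exact: geosum_le_nat.
apply: exprn_ile1; first by rewrite mulr_ge0 ?cabs_ge0 ?invr_ge0.
by rewrite ler_pdivrMr ?ltr0n// mul1r; exact: geosum_le_nat.
Qed.

(** A sum of phihat of length K equals, up to 4cH, its average over the shifts
a + b with 1 <= a, b <= H, because no shift exceeds 2H; the average is a sum of phi
against the kernel by the definition of phihat. *)
Lemma fourier_sum_smoothing (R : realType) m (phi : int -> R[i]%C) (c : R) K H :
  (0 < H)%N -> (forall h, cabs (fourier m phi h) <= c) ->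
  cabs (\sum_(n < K) fourier m phi n.+1%:Z) <=
    4 * c * H%:R + (Num.sqrt m%:R)^-1 *
      cabs (\sum_(x < m) phi x%:Z * skernel K H (expe (x%:R / m%:R))).
Proof.
move=> H0 hc.
have H0' : 0 < H%:R :> R by rewrite ltr0n.
have HC : (H%:R : R[i]%C) != 0 by rewrite pnatr_eq0 -lt0n.
have fE (n : nat) : fourier m phi n%:Z =
    \sum_(x < m) ((Num.sqrt m%:R)^-1)%:C%C * phi x%:Z * expe (x%:R / m%:R) ^+ n.
  rewrite /fourier mulr_sumr; apply: eq_bigr => x _.
  by rewrite [LHS]mulrA -expeMn mulrA -pmulrn.
have alg (s p z : R[i]%C) : s * p * geosum z K * geosum z H * geosum z H =
    H%:R ^+ 2 * (s * (p * skernel K H z)).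
  by rewrite /skernel; field.
set S := \sum_(n < K) _.
pose T := \sum_(a < H) \sum_(b < H) \sum_(n < K) fourier m phi ((a.+1 + b.+1) + n.+1)%N%:Z.
have TE : T = H%:R ^+ 2 * (((Num.sqrt m%:R)^-1)%:C%C *
    \sum_(x < m) phi x%:Z * skernel K H (expe (x%:R / m%:R))).
  rewrite /T; under eq_bigr => a _ do under eq_bigr => b _ do
    (under eq_bigr => n _ do rewrite fE; rewrite sum_expr_geosum).
  under eq_bigr => a _ do rewrite sum_expr_geosum -[a.+1]add0n.
  rewrite sum_expr_geosum !mulr_sumr; apply: eq_bigr => x _.
  by rewrite expr0 mulr1; exact: alg.
have ST : cabs (H%:R ^+ 2 * S - T) <= H%:R ^+ 2 * (4 * c * H%:R).
  have -> : H%:R ^+ 2 * S - T = \sum_(a < H) \sum_(b < H)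
     (S - \sum_(n < K) fourier m phi ((a.+1 + b.+1) + n.+1)%N%:Z).
    rewrite /T; under [RHS]eq_bigr do rewrite sumrB sumr_const card_ord.
    by rewrite sumrB sumr_const card_ord expr2 -natrM mulr_natl mulrnA.
  apply: le_trans (ler_cabs_sum _ _ _) _.
  have -> : H%:R ^+ 2 * (4 * c * H%:R) = \sum_(a < H) \sum_(b < H) (4 * c * H%:R).
    by rewrite !sumr_const !card_ord expr2 -natrM mulr_natl mulrnA.
  apply: ler_sum => a _; apply: le_trans (ler_cabs_sum _ _ _) _.
  apply: ler_sum => b _.
  apply: le_trans (sum_shift_le (F := fun n : nat => fourier m phi n%:Z) _ _ _) _ => //.
  have c0 : 0 <= c := le_trans (cabs_ge0 _) (hc 0).
  have ab : (a.+1 + b.+1)%:R <= H%:R + H%:R :> R.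
    by rewrite -natrD ler_nat leq_add.
  by nra.
have {ST} ST : cabs (S - H%:R ^- 2 * T) <= 4 * c * H%:R.
  have E : H%:R ^+ 2 * S - T = H%:R ^+ 2 * (S - H%:R ^- 2 * T).
    by rewrite mulrBr mulVKf ?expf_neq0.
  by move: ST; rewrite E cabsM cabsX cabs_nat ler_pM2l// exprn_gt0.
have -> : S = (S - H%:R ^- 2 * T) + H%:R ^- 2 * T by rewrite subrK.
apply: le_trans (ler_cabsD _ _) _; apply: lerD => //.
rewrite TE mulKf ?expf_neq0// cabsM cabsR ger0_norm//.
Qed.

(** * Sums of the Fourier transform *)

(** The three terms come from the smoothing, from the residue 0, where the kernel is
at most K, and from the two sides of the origin. *)
Lemma fourier_sum_le (R : realType) m (phi : int -> R[i]%C) (c Q M : R) K H :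
  (1 < m)%N -> periodic_mod m phi -> 0 <= Q -> 0 <= M -> M * K%:R <= m%:R ->
  (0 < H <= K)%N ->
  (forall x, cabs (phi x) <= c) -> (forall h, cabs (fourier m phi h) <= c) ->
  (forall t, (0 < t)%N -> t%:R <= m%:R / 2 :> R ->
    cabs (\sum_(i < t) phi i.+1%:Z) <= Q * Num.max t%:R M /\
    cabs (\sum_(i < t) phi (- i.+1%:Z)) <= Q * Num.max t%:R M) ->
  cabs (\sum_(n < K) fourier m phi n.+1%:Z) <=
    4 * c * H%:R + (Num.sqrt m%:R)^-1 *
      (c * K%:R + 2 * ((24 * pi + 4) * (Q * K%:R * m%:R / H%:R))).
Proof.
move=> m1 pf Q0 M0 MK HK phic hatc phiQ.
have [H0 _] := andP HK.
have m0 : 0 < m%:R :> R by rewrite ltr0n ltnW.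
have m2 : 2 <= m%:R :> R by rewrite ler_nat.
apply: le_trans (fourier_sum_smoothing K H0 hatc) _; rewrite lerD2l.
apply: ler_wpM2l; first by rewrite invr_ge0 sqrtr_ge0.
pose g (x : int) := phi x * skernel K H (expe (x%:~R / m%:R)).
have pg : periodic_mod m g.
  move=> x; rewrite /g pf; congr (_ * skernel _ _ _).
  rewrite intrD -pmulrn mulrDl divff ?lt0r_neq0//.
  exact: (expe_intD _ 1).
rewrite (eq_bigr (fun x : 'I_m => g x%:Z)); last by [].
rewrite (sum_periodic_split (L := m./2) (L' := (m.-1)./2) pg); last by lia.
have half_le (t k : nat) : (t <= k./2)%N -> (k <= m)%N -> t%:R <= m%:R / 2 :> R.
  move=> tk km; rewrite ler_pdivlMr// -natrM ler_nat; lia.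
have expe_ge (s : R) t : s = 1 \/ s = -1 -> (0 < t)%N -> t%:R <= m%:R / 2 :> R ->
    2 * t%:R / m%:R <= cabs (expe (s / m%:R) ^+ t - 1).
  move=> s1 t0 tm.
  have h : 2 * (t%:R / m%:R) <= cabs (expe (t%:R / m%:R : R) - 1).
    apply: expe_sub1_ge; rewrite divr_ge0 ?ler0n//=.
    by rewrite ler_pdivrMr// mulrC mulrA mulr1.
  rewrite -mulrA; case: s1 => ->; rewrite -expeMn.
    by rewrite div1r.
  by rewrite mulN1r mulrN cabs_expeN_sub1.
have expe_le (s : R) : s = 1 \/ s = -1 ->
    cabs (expe (s / m%:R) - 1) <= 2 * pi / m%:R.
  have h : cabs (expe (m%:R^-1 : R) - 1) <= 2 * pi / m%:R.
    apply: expe_sub1_le; rewrite invr_ge0 ltW//= invf_le1//; lra.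
  by case=> ->; rewrite ?mul1r// mulN1r cabs_expeN_sub1.
apply: le_trans (ler_cabsD _ _) _; apply: le_trans (lerD (ler_cabsD _ _) (lexx _)) _.
rewrite mulr2n mulrDl mul1r addrA; apply: lerD; first apply: lerD.
- rewrite /g mul0r expe_zero cabsM; apply: ler_pM; rewrite ?cabs_ge0//.
  by apply: skernel_le => //; exact: cabs1.
- rewrite (eq_bigr (fun i : 'I_(m./2) =>
    phi i.+1%:Z * skernel K H (expe (1 / m%:R) ^+ i.+1))); last first.
    by move=> i _; rewrite /g -expeMn div1r.
  apply: (one_sided_sum_le (f := fun i : nat => phi i%:Z) m0 Q0 M0 MK HK).
  + by move=> _; rewrite -natrM ler_nat; lia.
  + by move=> t /andP[t0 tm]; apply: (phiQ t t0 _).1; exact: half_le tm _.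
  + exact: cabs_expe.
  + by apply: expe_le; left.
  + move=> t /andP[t0 tm]; apply: expe_ge => //; first by left.
    exact: half_le tm _.
rewrite (eq_bigr (fun i : 'I_((m.-1)./2) =>
  phi (- i.+1%:Z) * skernel K H (expe (-1 / m%:R) ^+ i.+1))); last first.
  by move=> i _; rewrite /g -expeMn mulN1r mulrN mulrNz mulNr.
apply: (one_sided_sum_le (f := fun i : nat => phi (- i%:Z)) m0 Q0 M0 MK HK).
- by move=> h; rewrite -natrM ler_nat; lia.
- by move=> t /andP[t0 tm]; apply: (phiQ t t0 _).2; apply: half_le tm _; exact: leq_pred.
- exact: cabs_expe.
- by apply: expe_le; right.
- move=> t /andP[t0 tm]; apply: expe_ge => //; first by right.
  by apply: half_le tm _; exact: leq_pred.
Qed.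

(** Optimisation of H in the previous bound: H is the integer part of
X = sqrt(N D sqrt(m)), and X / 2 <= H <= X. *)
Lemma fourier_sum_le_sqrt (R : realType) m (phi : int -> R[i]%C) (c D N : R) :
  (1 < m)%N -> periodic_mod m phi -> 1 <= N <= m%:R -> (Num.sqrt m%:R)^-1 <= D ->
  (forall x, cabs (phi x) <= c) -> (forall h, cabs (fourier m phi h) <= c) ->
  (forall t, (0 < t)%N -> t%:R <= m%:R / 2 :> R ->
    cabs (\sum_(i < t) phi i.+1%:Z) <= c * D * Num.max t%:R (m%:R / N) /\
    cabs (\sum_(i < t) phi (- i.+1%:Z)) <= c * D * Num.max t%:R (m%:R / N)) ->
  cabs (\sum_(n < Num.truncn N) fourier m phi n.+1%:Z) <=
    (96 * pi + 21) * (c * Num.sqrt (N * D * Num.sqrt m%:R)).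
Proof.
move=> m1 pf /andP[N1 Nm] Dm phic hatc phiQ.
have c0 : 0 <= c := le_trans (cabs_ge0 _) (phic 0).
have pi0 : 0 <= pi :> R := pi_ge0 R.
have m0 : 0 < m%:R :> R by rewrite ltr0n ltnW.
have s0 : 0 < Num.sqrt m%:R :> R by rewrite sqrtr_gt0.
have ss : Num.sqrt m%:R ^+ 2 = m%:R :> R by rewrite sqr_sqrtr// ltW.
have N0 : 0 < N by lra.
have D0 : 0 < D by apply: lt_le_trans Dm; rewrite invr_gt0.
have Ds : 1 <= D * Num.sqrt m%:R by rewrite -ler_pdivrMr// div1r.
set s := Num.sqrt m%:R in s0 ss Ds *.
set X := Num.sqrt _.
have X2 : X ^+ 2 = N * D * s by rewrite sqr_sqrtr// !mulr_ge0// ltW.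
have X0 : 0 <= X by exact: sqrtr_ge0.
have NX : N <= X ^+ 2 by rewrite X2 -mulrA ler_peMr// ltW.
have X1 : 1 <= X by rewrite -(ler_sqr (ler01 : 1 \in Num.nneg)) ?nnegrE// expr1n; lra.
set K := Num.truncn N.
have KN : K%:R <= N by rewrite truncn_le ltW.
(* If K <= X, the trivial bound c K is enough. *)
have [XK|KX] := ltP X K%:R; last first.
  apply: le_trans (ler_cabs_sum _ _ _) _.
  apply: le_trans (_ : \sum_(n < K) c <= _); first by apply: ler_sum.
  rewrite sumr_const card_ord -mulr_natr.
  have h : c * K%:R <= c * X by apply: ler_wpM2l.
  have : 0 <= c * X by rewrite mulr_ge0.
  by nra.
pose H := Num.truncn X.
have HX : H%:R <= X by rewrite truncn_le.
have XH : X < H%:R + 1 by rewrite natr1; exact: truncnS_gt.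
have H1 : (0 < H)%N by rewrite truncn_gt0.
have H1' : 1 <= H%:R :> R by rewrite ler1n.
have HK : (0 < H <= K)%N.
  by rewrite H1 -(ler_nat R) (le_trans HX)// ltW.
have MK : m%:R / N * K%:R <= m%:R by rewrite mulrAC ler_pdivrMr// ler_pM2l.
have Q0 : 0 <= c * D by rewrite mulr_ge0// ltW.
have M0 : 0 <= m%:R / N by rewrite divr_ge0// ltW.
apply: le_trans (fourier_sum_le m1 pf Q0 M0 MK HK phic hatc phiQ) _.
rewrite -/s.
have e1 : 4 * c * H%:R <= 4 * (c * X) by rewrite -mulrA ler_wpM2l// ler_wpM2l.
(* From N <= X^2 and N <= m = s^2; this bounds the term of the residue 0. *)
have Ns : N <= X * s.
  rewrite -ler_sqr ?nnegrE ?mulr_ge0 ?(ltW N0) ?(ltW s0)// exprMn ss expr2.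
  by apply: ler_pM => //; rewrite ltW.
have e2 : s^-1 * (c * K%:R) <= c * X.
  rewrite mulrC ler_pdivrMr// -mulrA; apply: ler_wpM2l => //.
  exact: le_trans KN Ns.
have e3 : s^-1 * (c * D * K%:R * m%:R / H%:R) <= 2 * (c * X).
  have -> : s^-1 * (c * D * K%:R * m%:R / H%:R) = c * ((K%:R * (D * s)) / H%:R).
    by rewrite -ss; field; rewrite !lt0r_neq0// ltr0n.
  rewrite [leRHS]mulrCA; apply: ler_wpM2l => //.
  rewrite ler_pdivrMr ?ltr0n//.
  apply: le_trans (_ : X ^+ 2 <= _).
    by rewrite X2 -mulrA ler_wpM2r// mulr_ge0// ltW.
  by rewrite expr2 [2 * X]mulrC -mulrA ler_wpM2l//; lra.
rewrite mulrDr [s^-1 * (2 * _)]mulrCA [s^-1 * ((24 * pi + 4) * _)]mulrCA.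
have e4 : (24 * pi + 4) * (s^-1 * (c * D * K%:R * m%:R / H%:R)) <=
    (24 * pi + 4) * (2 * (c * X)).
  by apply: ler_wpM2l => //; rewrite addr_ge0// mulr_ge0.
have -> : (96 * pi + 21) * (c * X) =
  4 * (c * X) + (c * X + 2 * ((24 * pi + 4) * (2 * (c * X)))) by ring.
by apply: lerD => //; apply: lerD => //; rewrite ler_pM2l.
Qed.

(** * The quantity Delta *)

Lemma short_sumE (R : realType) (f : int -> R[i]%C) (t : R) : 1 <= t ->
  short_sum f t = \sum_(i < Num.truncn t) f i.+1%:Z /\
  short_sum f (- t) = \sum_(i < Num.truncn t) f (- i.+1%:Z).
Proof.
move=> t1; have t0 : 0 < t by lra.
rewrite /short_sum oppr_ge0 (ltW t0) leNgt t0 /= opprK.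
by rewrite !big_add1 !big_mkord.
Qed.

Lemma Delta_term_le_Delta (R : realType) (c : R) m f (N t : R) :
  0 < c -> 0 < N -> (1 < m)%N -> 1 <= t <= m%:R / 2 ->
  (Num.sqrt m%:R)^-1 + Delta_term c f N t <= Delta c m f N.
Proof.
move=> c0 N0 m1 tm; rewrite lerD2l; apply: ub_le_sup; last by exists t.
have [u _ umax] := Delta_term_max f c0 N0 m1.
by exists (Delta_term c f N u) => _ [v vm <-]; exact: umax.
Qed.

Lemma Delta_le (R : realType) (c : R) m f (N Z : R) : (1 < m)%N ->
  (forall t, 1 <= t <= m%:R / 2 -> (Num.sqrt m%:R)^-1 + Delta_term c f N t <= Z) ->
  Delta c m f N <= Z.
Proof.
move=> m1 tZ; rewrite -lerBrDl; apply: ge_sup.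
  exists (Delta_term c f N 1), 1 => //; rewrite /= lexx /= ler_pdivlMr// mul1r ler_nat//.
by move=> _ [t tm <-]; rewrite lerBrDl; exact: tZ.
Qed.

(** The minimum in the definition is the inverse of c max(t, N), which is the form
of the bounds for partial sums used in the summation by parts. *)
Lemma Delta_termE (R : realType) (c : R) f (N t : R) : 0 < c -> 0 < N -> 0 < t ->
  Delta_term c f N t =
  (c * Num.max t N)^-1 * (cabs (short_sum f t) + cabs (short_sum f (- t))).
Proof.
move=> c0 N0 t0; rewrite /Delta_term; congr (_ * _).
have [tN|Nt] := leP t N.
  by apply/min_idPr; rewrite lef_pV2 ?posrE ?mulr_gt0// ler_pM2l.
by apply/min_idPl; rewrite lef_pV2 ?posrE ?mulr_gt0// ler_pM2l// ltW.
Qed.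

Lemma Delta_term_ge0 (R : realType) (c : R) f (N t : R) : 0 < c -> 0 < N -> 0 < t ->
  0 <= Delta_term c f N t.
Proof.
move=> c0 N0 t0; rewrite Delta_termE// mulr_ge0 ?addr_ge0 ?cabs_ge0//.
by rewrite invr_ge0 mulr_ge0 ?le_max ?ltW.
Qed.

Lemma Delta_ge (R : realType) (c : R) m f (N : R) : 0 < c -> 0 < N -> (1 < m)%N ->
  (Num.sqrt m%:R)^-1 <= Delta c m f N.
Proof.
move=> c0 N0 m1.
have h1 : 1 <= (1 : R) <= m%:R / 2 by rewrite lexx /= ler_pdivlMr// mul1r ler_nat.
apply: le_trans (Delta_term_le_Delta f c0 N0 m1 h1).
by rewrite lerDl Delta_term_ge0.
Qed.

Lemma short_sum_le_Delta (R : realType) (c : R) m f (N t : R) :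
  0 < c -> 0 < N -> (1 < m)%N -> 1 <= t <= m%:R / 2 ->
  cabs (short_sum f t) + cabs (short_sum f (- t)) <=
    c * Delta c m f N * Num.max t N.
Proof.
move=> c0 N0 m1 tm; have t0 : 0 < t by case/andP: tm => h _; lra.
have := Delta_term_le_Delta f c0 N0 m1 tm; rewrite Delta_termE//.
have s0 : 0 <= (Num.sqrt m%:R)^-1 :> R by rewrite invr_ge0 sqrtr_ge0.
have mx : 0 < c * Num.max t N by rewrite mulr_gt0 ?lt_max ?t0.
move=> h; have : (c * Num.max t N)^-1 *
   (cabs (short_sum f t) + cabs (short_sum f (- t))) <= Delta c m f N by lra.
rewrite ler_pdivrMl// => h2; apply: le_trans h2 _.
by rewrite le_eqVlt; apply/orP; left; apply/eqP; ring.
Qed.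

(** Because 1 / max(t, N) is nonincreasing in N. *)
Lemma Delta_antitone (R : realType) (c : R) m f (N N' : R) :
  0 < c -> 0 < N -> (1 < m)%N -> N <= N' -> Delta c m f N' <= Delta c m f N.
Proof.
move=> c0 N0 m1 NN; have N0' : 0 < N' by lra.
apply: Delta_le => // t tm; apply: le_trans (Delta_term_le_Delta f c0 N0 m1 tm).
have t0 : 0 < t by case/andP: tm => h _; lra.
rewrite lerD2l !Delta_termE// ler_wpM2r ?addr_ge0 ?cabs_ge0//.
rewrite lef_pV2 ?posrE ?mulr_gt0 ?lt_max ?t0// ler_pM2l//.
by rewrite ge_max !le_max lexx NN orbT.
Qed.

(** Both N * m^(-1/2) and N / max(t, N) = min(N / t, 1) are nondecreasing in N. *)
Lemma mul_Delta_monotone (R : realType) (c : R) m f (N N' : R) :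
  0 < c -> 0 < N -> (1 < m)%N -> N <= N' ->
  N * Delta c m f N <= N' * Delta c m f N'.
Proof.
move=> c0 N0 m1 NN; have N0' : 0 < N' by lra.
rewrite -ler_pdivlMl//; apply: Delta_le => // t tm.
have t0 : 0 < t by case/andP: tm => h _; lra.
rewrite ler_pdivlMl//; apply: le_trans
  (_ : N' * ((Num.sqrt m%:R)^-1 + Delta_term c f N' t) <= _); last first.
  by rewrite ler_pM2l// Delta_term_le_Delta.
rewrite !mulrDr; apply: lerD; first by rewrite ler_wpM2r// invr_ge0 sqrtr_ge0.
rewrite !Delta_termE// !mulrA ler_wpM2r ?addr_ge0 ?cabs_ge0//.
have mx (x : R) : 0 < x -> 0 < c * Num.max t x.
  by move=> x0; rewrite mulr_gt0 ?lt_max ?t0.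
rewrite ler_pdivrMr ?mx// mulrAC ler_pdivlMr ?mx//.
rewrite mulrCA [leRHS]mulrCA ler_pM2l//.
rewrite !maxr_pMr ?(ltW N0) ?(ltW N0')// ge_max !le_max [N * N']mulrC lexx orbT andbT.
by rewrite ler_pM2r// NN.
Qed.

(** * Short sums and Delta for the Fourier transform *)

Lemma powR_quarter (R : realType) (m : nat) :
  m%:R `^ 4^-1 = Num.sqrt (Num.sqrt m%:R) :> R.
Proof.
rewrite -!powR12_sqrt ?sqrtr_ge0// -powRrM; congr (_ `^ _).
by rewrite -invfM -natrM.
Qed.

(** The sum over negative integers is the sum over positive ones for the function
x |-> phi (- x), whose short sums are those of phi with the two signs exchanged. *)
Lemma fourier_short_sum_le (R : realType) m (phi : int -> R[i]%C) (N : R) :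
  (1 < m)%N -> periodic_mod m phi -> 0 < cmax m phi -> 1 <= N <= m%:R / 2 ->
  cabs (short_sum (fourier m phi) N) + cabs (short_sum (fourier m phi) (- N)) <=
    2 * (96 * pi + 21) * (cmax m phi *
      Num.sqrt (N * Delta (cmax m phi) m phi (m%:R / N) * Num.sqrt m%:R)).
Proof.
move=> m1 pf c0 /andP[N1 Nm]; set c := cmax m phi in c0 *.
have m0 : (0 < m)%N by exact: ltnW.
have m0' : 0 < m%:R :> R by rewrite ltr0n.
have phic x : cabs (phi x) <= c.
  by rewrite (le_trans (cabs_le_supnorm x m0 pf))// le_max lexx.
have hatc h : cabs (fourier m phi h) <= c.
  rewrite (le_trans (cabs_le_supnorm h m0 (fourier_periodic phi m0)))//.
  by rewrite le_max lexx orbT.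
have MN : 0 < m%:R / N by rewrite divr_gt0//; lra.
set D := Delta _ _ _ _.
have Dm : (Num.sqrt m%:R)^-1 <= D by exact: Delta_ge.
have NM : 1 <= N <= m%:R by apply/andP; split => //; lra.
have phiQ t : (0 < t)%N -> t%:R <= m%:R / 2 :> R ->
    cabs (\sum_(i < t) phi i.+1%:Z) <= c * D * Num.max t%:R (m%:R / N) /\
    cabs (\sum_(i < t) phi (- i.+1%:Z)) <= c * D * Num.max t%:R (m%:R / N).
  move=> t0 tm; have t1 : 1 <= t%:R :> R by rewrite ler1n.
  have tt : 1 <= (t%:R : R) <= m%:R / 2 by rewrite t1.
  have := short_sum_le_Delta phi c0 MN m1 tt.
  have [-> ->] := short_sumE phi t1; rewrite natrK -/D.
  set u := cabs _; set v := cabs _ => h.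
  have u0 : 0 <= u by exact: cabs_ge0.
  have v0 : 0 <= v by exact: cabs_ge0.
  by split; lra.
have [-> ->] := short_sumE (fourier m phi) N1.
rewrite -mulrA [2 * _]mulr_natl [leRHS]mulr2n; apply: lerD.
  exact: fourier_sum_le_sqrt.
pose psi x := phi (- x).
have psiE n : fourier m phi (- n) = fourier m psi n by rewrite fourier_opp.
under eq_bigr do rewrite psiE.
apply: fourier_sum_le_sqrt => //; first exact: periodic_opp.
- by move=> x; exact: phic.
- by move=> h; rewrite -psiE.
- move=> t t0 tm; have [h1 h2] := phiQ t t0 tm; split => //.
Qed.

(** The bound for short sums is applied at every t of the supremum.  For t <= N both
t and Delta(phi, m/t) are at most their values at N; for t >= N it is
Delta(phi, m/t) / t that is at most its value at N. *)
Lemma Delta_fourier_le (R : realType) m (phi : int -> R[i]%C) (N : R) :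
  (1 < m)%N -> periodic_mod m phi -> 0 < cmax m phi -> 1 <= N <= m%:R / 2 ->
  Delta (cmax m phi) m (fourier m phi) N <=
    (2 * (96 * pi + 21) + 1) *
    (m%:R `^ 4^-1 / Num.sqrt N *
      Num.sqrt (Delta (cmax m phi) m phi (m%:R / N))).
Proof.
move=> m1 pf c0 N1m; set c := cmax m phi in c0 *.
have /andP[N1 Nm] := N1m.
have N0 : 0 < N by lra.
have m0 : 0 < m%:R :> R by rewrite ltr0n ltnW.
set C := 2 * (96 * pi + 21).
have C0 : 0 <= C by rewrite mulr_ge0 ?addr_ge0 ?mulr_ge0 ?pi_ge0.
pose s : R := Num.sqrt m%:R.
have s0 : 0 < s by rewrite sqrtr_gt0.
have ss : s ^+ 2 = m%:R by rewrite sqr_sqrtr// ltW.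
pose D (t : R) := Delta c m phi (m%:R / t).
have Dm t : 0 < t -> s^-1 <= D t by move=> t0; apply: Delta_ge => //; rewrite divr_gt0.
have D0 t : 0 < t -> 0 < D t.
  by move=> t0; apply: lt_le_trans (Dm _ t0); rewrite invr_gt0.
rewrite -/(D N); set Y := _ / _ * _.
have Y0 : 0 <= Y by rewrite /Y powR_quarter !mulr_ge0 ?invr_ge0 ?sqrtr_ge0.
have Y2 : Y ^+ 2 = s * D N / N.
  rewrite /Y powR_quarter !exprMn exprVn !sqr_sqrtr ?(ltW s0) ?(ltW N0)//.
    by rewrite mulrAC.
  by rewrite ltW// D0.
(* The part m^(-1/2) of Delta: Y^2 = s D(N) / N >= 1 / N >= 1 / m. *)
have Ys : s^-1 <= Y.
  rewrite -ler_sqr ?nnegrE ?invr_ge0 ?(ltW s0)// Y2 exprVn ss.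
  have : 1 <= s * D N by rewrite -ler_pdivrMl// mulr1 Dm.
  move=> h; apply: le_trans (_ : N^-1 <= _).
    by rewrite lef_pV2 ?posrE//; lra.
  by rewrite -[leLHS]mul1r ler_pM2r ?invr_gt0.
apply: Delta_le => // t tm; have /andP[t1 tm'] := tm.
have t0 : 0 < t by lra.
rewrite mulrDl mul1r [leRHS]addrC; apply: lerD => //.
rewrite Delta_termE// ler_pdivrMl; last by rewrite mulr_gt0// lt_max t0.
apply: le_trans (fourier_short_sum_le m1 pf c0 tm) _.
rewrite -/C -/c -/s -/(D t).
have -> : c * Num.max t N * (C * Y) = C * (c * (Num.max t N * Y)) by ring.
apply: ler_wpM2l => //; rewrite ler_pM2l//.
have mx0 : 0 <= Num.max t N by rewrite le_max ltW.
rewrite -ler_sqr ?nnegrE ?sqrtr_ge0 ?mulr_ge0// exprMn Y2 sqr_sqrtr; last first.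
  by rewrite !mulr_ge0 ?ltW// D0.
have -> : Num.max t N ^+ 2 * (s * D N / N) = Num.max t N ^+ 2 * (D N / N) * s by ring.
rewrite ler_pM2r//.
have [tN|Nt] := leP t N.
  have -> : N ^+ 2 * (D N / N) = N * D N by field; rewrite lt0r_neq0.
  apply: ler_pM => //; rewrite ?(ltW t0) ?(ltW (D0 _ t0))//.
  apply: Delta_antitone => //; first by rewrite divr_gt0.
  by rewrite ler_pM2l// lef_pV2.
have : m%:R / t * D t <= m%:R / N * D N.
  apply: mul_Delta_monotone => //; first by rewrite divr_gt0.
  by rewrite ler_pM2l// lef_pV2 ?posrE// ltW.
rewrite -!mulrA ler_pM2l// => h.
have -> : t * D t = t ^+ 2 * (t^-1 * D t) by field; rewrite lt0r_neq0.
by rewrite [leRHS]mulrA -expr2 [D N / N]mulrC ler_pM2l// exprn_gt0.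
Qed.

Lemma cmax_gt0 (R : realType) m (phi : int -> R[i]%C) : (0 < m)%N ->
  periodic_mod m phi -> (exists x : int, phi x != 0) -> 0 < cmax m phi.
Proof.
move=> m0 pf [x x0]; rewrite lt_max; apply/orP; left.
apply: lt_le_trans (cabs_le_supnorm x m0 pf).
rewrite lt0r cabs_ge0 andbT; apply: contra x0 => /eqP h.
by apply/eqP; exact: Normc.eq0_normc h.
Qed.

Theorem theorem1p2 (R : realType) :
  exists C1 C2 C3 : R,
    forall (m : nat) (phi : int -> R[i]%C),
      (1 <= m)%N ->
      periodic_mod m phi ->
      (exists x : int, phi x != 0) ->
      let c := cmax m phi in
      let phihat := fourier m phi in
      (forall N : R, 2 <= N <= m%:R / 2 ->
         cabs (short_sum phihat N) + cabs (short_sum phihat (- N))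
           <= C1 * (c * Num.sqrt N * m%:R `^ 4^-1
                    * Num.sqrt (Delta c m phi (m%:R / N)))
         /\
         Delta c m phihat N
           <= C2 * (m%:R `^ 4^-1 / Num.sqrt N
                    * Num.sqrt (Delta c m phi (m%:R / N))))
      /\
      ((4 <= m)%N ->
         Delta c m phihat (Num.sqrt m%:R)
           <= C3 * Num.sqrt (Delta c m phi (Num.sqrt m%:R))).
Proof.
pose C : R := 2 * (96 * pi + 21).
exists C, (C + 1), (C + 1) => m phi m0 pf phi0 c phihat.
have c0 : 0 < c by exact: cmax_gt0.
split=> [N /andP[N2 Nm]|m4].
  have N0 : 0 < N by lra.
  have m1 : (1 < m)%N by rewrite -(ltr_nat R); lra.
  have Nm1 : 1 <= N <= m%:R / 2 by apply/andP; split => //; lra.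
  split; last exact: Delta_fourier_le.
  apply: le_trans (fourier_short_sum_le m1 pf c0 Nm1) _.
  set D := Delta _ _ _ _.
  have D0 : 0 <= D.
    apply: le_trans (Delta_ge _ c0 _ m1); first by rewrite invr_ge0 sqrtr_ge0.
    by rewrite divr_gt0// ltr0n.
  rewrite powR_quarter sqrtrM ?mulr_ge0 ?(ltW N0)// sqrtrM ?(ltW N0)//.
  by rewrite le_eqVlt; apply/orP; left; apply/eqP; rewrite /C -/c; ring.
have m1 : (1 < m)%N by exact: leq_trans m4.
have mr : 4 <= m%:R :> R by rewrite ler_nat.
pose s : R := Num.sqrt m%:R.
have ss : s ^+ 2 = m%:R by rewrite sqr_sqrtr.
have s0 : 0 <= s by exact: sqrtr_ge0.
have s2 : 2 <= s by nra.
have sm : 1 <= s <= m%:R / 2 by apply/andP; split; nra.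
have := Delta_fourier_le m1 pf c0 sm.
have -> : m%:R / s = s by rewrite -ss; field; rewrite lt0r_neq0//; lra.
by rewrite powR_quarter -/s divff ?mul1r// sqrtr_eq0 -ltNge; lra.
Qed.
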